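(* Let $t\ge 3$ and let $2\le \ell_1\le\ell_2\le\cdots\le\ell_t$ be integers. If $\ell_t<p(\ell_1,\ldots,\ell_{t-1})$, then $p(\ell_1,\ldots,\ell_t)\le \left\lfloor\frac{\ell_1+2\ell_2+\cdots+2^{t-1}\ell_t-2}{2^t-2}\right\rfloor$.
   Context: $P_m$ denotes the path with $m$ vertices. For integers $k\ge 2$ and $\ell_1,\ldots,\ell_k\ge 2$, $p(\ell_1,\ldots,\ell_k)$ denotes the least integer $n$ such that for every colouring of the edges of $K_n$ with colours $1,\ldots,k$ there is some $i\in\{1,\ldots,k\}$ and a copy of $P_{\ell_i}$ in $K_n$ none of whose edges has colour $i$. *)

(* Defs.v *)
From mathcomp Require Import all_boot.

Set Implicit Arguments.
Unset Strict Implicit.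
Unset Printing Implicit Defensive.

(* The vertices of K_n are 'I_n and an edge colouring with k colours is a map
   c : {ffun {set 'I_n} -> 'I_k}, read only at the 2-element sets [set x; y].
   Colours and the parameters l are numbered from 0: the informal
   p(l_1, ..., l_k) is [p k l] with l_i = l i.-1; only l 0, ..., l k.-1 matter. *)

(* s lists, in order, the vertices of a path of K_n none of whose edges has
   colour i. *)
Definition avoiding_path (n k : nat) (c : {ffun {set 'I_n} -> 'I_k})
    (i : 'I_k) (s : seq 'I_n) : bool :=
  uniq s && sorted (fun x y => c [set x; y] != i) s.

Definition path_unavoidable (k : nat) (l : nat -> nat) (n : nat) : bool :=
  [forall c : {ffun {set 'I_n} -> 'I_k},
    [exists i : 'I_k, [exists s : (l i).-tuple 'I_n, avoiding_path c i s]]].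

Lemma avoiding_path_partition (n k : nat) (c : {ffun {set 'I_n} -> 'I_k})
    (i j : 'I_k) (s : seq 'I_n) : i != j ->
  exists a b, [/\ perm_eq (a ++ b) s,
    sorted (fun x y => c [set x; y] != i) a &
    sorted (fun x y => c [set x; y] != j) b].
Proof.
move=> ij; elim: s => [|x s [a [b [ps sa sb]]]]; first by exists [::], [::].
case: a ps sa => [|u a] ps sa.
  by exists [:: x], b; split=> //; rewrite /= perm_cons.
case: b ps sb => [|v b] ps sb.
  exists (u :: a), [:: x]; split=> //.
  by rewrite perm_catC /= perm_cons; rewrite cats0 in ps.
have [xu|xu] := boolP (c [set x; u] != i).
  by exists [:: x, u & a], (v :: b); split; rewrite /= ?xu // perm_cons.
have [xv|xv] := boolP (c [set x; v] != j).
  exists (u :: a), [:: x, v & b]; split; rewrite /= ?xv //.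
  by rewrite -cat_cons perm_catC /= perm_cons -cat_cons perm_catC.
move: xu xv; rewrite !negbK => /eqP xu /eqP xv.
have [uv|uv] := boolP (c [set u; v] != i).
  exists [:: x, v, u & a], b; split.
  - rewrite /= perm_cons; apply: perm_trans ps.
    by rewrite -[_ :: _]/([:: v] ++ ((u :: a) ++ b)) perm_catCA.
  - by rewrite /= xv eq_sym ij /= setUC uv.
  - exact: path_sorted sb.
move: uv; rewrite negbK => /eqP uv.
exists a, [:: x, u, v & b]; split.
- rewrite perm_catC /= perm_cons; apply: perm_trans ps.
  by rewrite perm_cons -cat_cons perm_catC.
- exact: path_sorted sa.
- by rewrite /= xu uv ij.
Qed.

Lemma path_unavoidable_ex (k : nat) (l : nat -> nat) :
  exists n, (1 < k) ==> path_unavoidable k l n.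
Proof.
case: (ltnP 1 k) => [k1|_]; last by exists 0.
pose i : 'I_k := Ordinal (ltnW k1); pose j : 'I_k := Ordinal k1.
exists (l i + l j); apply/forallP => c.
have [a [b [pab sa sb]]] := avoiding_path_partition c (enum 'I_(l i + l j))
  (isT : i != j).
have := perm_uniq pab; rewrite enum_uniq cat_uniq => /and3P[ua _ ub].
have := perm_size pab; rewrite size_cat size_enum_ord => sz.
have tk (h : 'I_k) (s : seq 'I_(l i + l j)) : l h <= size s ->
    avoiding_path c h s -> [exists h : 'I_k,
      [exists s : (l h).-tuple 'I_(l i + l j), avoiding_path c h s]].
  move=> hs /andP[us ss]; apply/existsP; exists h; apply/existsP.
  have tP : size (take (l h) s) == l h by rewrite size_takel.
  exists (Tuple tP); apply/andP.
  by split; [exact: take_uniq | exact: take_sorted].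
have [la|la] := leqP (l i) (size a).
  by apply: (tk i a) => //; apply/andP.
apply: (tk j b); last by apply/andP.
by rewrite -(leq_add2l (l i)) -[leqLHS]sz leq_add2r ltnW.
Qed.

(* The guard 1 < k only serves to make p total: p k l = 0 for k < 2. *)
Definition p (k : nat) (l : nat -> nat) : nat :=
  ex_minn (path_unavoidable_ex k l).

Lemma p_least (k : nat) (l : nat -> nat) : 1 < k ->
  path_unavoidable k l (p k l) /\
  forall n, path_unavoidable k l n -> p k l <= n.
Proof.
by move=> k1; rewrite /p; case: ex_minnP => m; rewrite k1.
Qed.

(* Main.v *)
(* Write G_i for the graph of the edges of colour other than i, L_i for the
   order of its longest path and d_i = n - L_i.  Any two of the G_i cover K_n,
   and this alone gives an ordering of the colours with
     d_1 + 2 d_2 + ... + 2^(t-1) d_t < n;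
   the theorem follows by rearrangement.  If some d_i = 0, put i last and
   induct on t.  Otherwise take, over all colours j and all vertices x missed by
   a longest path of G_j, a pair (j, x) with the G_j-degree of x least.  Then
   deleting x shortens the longest path of every G_i, i <> j, by at least 2, so
   the d_i increase (i <> j), d_j drops by at most 1, and one inducts on n.

   For the claim, suppose a path R of G_i missing x has at least L_i - 1
   vertices, and let P be a longest path of G_j missing x.  The first vertex of
   P and the P-successors of the G_j-neighbours of x form with x a set K without
   edges of G_j, hence a clique of G_i.  Counting the R-successors of K against
   the G_j-neighbours of x on P shows that x can be inserted into R, possibly
   after rerouting.  So |R| = L_i - 1, and every vertex outside R and x is
   missed by a longest path of G_i.  A second count finds such a vertex whose
   G_i-degree is below the G_j-degree of x, against the choice of (j, x). *)

Require Import Defs.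
From mathcomp Require Import all_boot.
From mathcomp Require Import zify.

Set Implicit Arguments.
Unset Strict Implicit.
Unset Printing Implicit Defensive.

(* The two tactics identify the two spellings of the sort of a finType, which
   lia would treat as different atoms. *)
Ltac perm_count :=
  repeat match goal with
  | T : finType |- _ =>
    progress change (Equality.sort T) with (Finite.sort T)
  end;
  apply/permP => ?;
  do 4 rewrite /= -?cats1 ?count_cat ?count_rev;
  clear; lia.

Ltac nat_lia :=
  repeat match goal with x := _ |- _ => clearbody x end;
  repeat match goal with
  | T : finType |- _ =>
    progress change (Equality.sort T) with (Finite.sort T) in *
  end;
  repeat match goal with
  | H : ?P |- _ =>
    lazymatch P with
    | is_true (_ <= _) => fail
    | _ = _ :> nat => fail
    | nat => fail
    | _ => clear H
    end
  end;
  lia.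

(** * Successors along a sequence, and rerouting of paths *)

Section Sequences.

Variable T : eqType.
Implicit Types (e : rel T) (f : pred T) (s : seq T).

Lemma sorted_cat_cons e s1 a s2 :
  sorted e (s1 ++ a :: s2) = sorted e (rcons s1 a) && path e a s2.
Proof. by case: s1 => [|b s1] //=; rewrite -cat_rcons cat_path last_rcons. Qed.

Lemma path_sorted_head e a s :
  (forall b s', s = b :: s' -> e a b) -> sorted e s -> path e a s.
Proof. by case: s => [|b s] //= ab ->; rewrite (ab b s). Qed.

Lemma sorted_rev e s : symmetric e -> sorted e (rev s) = sorted e s.
Proof.
by move=> se; rewrite rev_sorted; apply: eq_sorted => x y; rewrite se.
Qed.

Lemma clique_sorted e s :
  uniq s -> {in s &, forall u v, u != v -> e u v} -> sorted e s.
Proof.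
elim: s => [|a [|b s] IH] //= /andP[aN us] es.
rewrite es ?inE ?eqxx ?orbT //=; last first.
  by apply: contraNneq aN => ->; rewrite inE eqxx.
by apply: IH => // u v uI vI; apply: es; rewrite in_cons ?uI ?vI orbT.
Qed.

(** With [f] the adjacency to a vertex, these are the successors of its neighbours along a path, as
    in rotation arguments. *)
Fixpoint succs f s : seq T :=
  if s is a :: s' then
    (if s' is b :: _ then if f a then [:: b] else [::] else [::]) ++ succs f s'
  else [::].

Lemma succs_cons2 f a b s :
  succs f [:: a, b & s] = (if f a then [:: b] else [::]) ++ succs f (b :: s).
Proof. by []. Qed.

Lemma mem_succs f s z : z \in succs f s ->
  exists s1 a s2, s = s1 ++ a :: z :: s2 /\ f a.
Proof.
elim: s => [|a [|b s] IH] //.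
rewrite [succs _ _]/= mem_cat => /orP[|/IH[s1 [c [s2 [-> fc]]]]]; last first.
  by exists (a :: s1), c, s2.
case: ifP => // fa; rewrite inE => /eqP->.
by exists [::], a, s.
Qed.

Lemma succs_mem f s1 a z s2 : f a -> z \in succs f (s1 ++ a :: z :: s2).
Proof.
move=> fa; elim: s1 => [|b s1 IH]; first by rewrite succs_cons2 fa inE eqxx.
case: s1 IH => [|c s1] IH; rewrite succs_cons2 mem_cat.
  by rewrite IH orbT.
by rewrite (IH : z \in succs f (c :: _)) orbT.
Qed.

Lemma succs_subseq f s : subseq (succs f s) (behead s).
Proof.
elim: s => [|a [|b s] IH] //; rewrite [behead _]/= -[X in subseq _ X]cat1s.
by apply: cat_subseq => //; case: (f a); rewrite /= ?eqxx.
Qed.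

Lemma size_succs f s :
  (forall s' a, s = rcons s' a -> ~~ f a) -> size (succs f s) = count f s.
Proof.
elim: s => [|a [|b s] IH] fN //.
  by have := fN [::] a erefl; rewrite /= => /negbTE->.
rewrite [succs _ _]/= size_cat IH /=; first by case: (f a).
by move=> s' c sE; apply: (fN (a :: s')); rewrite sE.
Qed.

(** Prepares [reroute]: [v'] and [w'] are [v] and [w] in their order on [s], with predecessors [a]
    and [last v' m]. *)
Lemma succs_order f s v w : v \in succs f s -> w \in succs f s -> v != w ->
  exists v' w', [/\ (v', w') = (v, w) \/ (v', w') = (w, v) &
    exists s1 a m s2, [/\ s = s1 ++ a :: (v' :: m) ++ w' :: s2, f a &
      f (last v' m)]].
Proof.
elim: s => [|a [|b s] IH] // vI wI vw.
have head c : f a -> c \in succs f (b :: s) -> exists s1 a' m s2,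
    [/\ [:: a, b & s] = s1 ++ a' :: (b :: m) ++ c :: s2, f a' & f (last b m)].
  move=> fa /mem_succs[[|b' t1] [c' [t2 [[-> ->] fc]]]].
    by exists [::], a, [::], t2.
  exists [::], a, (rcons t1 c'), t2; split=> //; last by rewrite last_rcons.
  by rewrite /= cat_rcons.
move: vI wI; rewrite !succs_cons2 (mem_cat v) (mem_cat w).
case fa: (f a); rewrite ?in_nil ?orFb; last first.
  move=> vI wI.
  have [v' [w' [vwE [s1 [c [m [s2 [-> fc fl]]]]]]]] := IH vI wI vw.
  by exists v', w'; split=> //; exists (a :: s1), c, m, s2.
rewrite !mem_seq1 => /orP[/eqP vb|vI] /orP[/eqP wb|wI].
- by rewrite vb wb eqxx in vw.
- exists v, w; split; first by left.
  by rewrite vb; apply: head.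
- exists w, v; split; first by right.
  by rewrite wb; apply: head.
have [v' [w' [vwE [s1 [c [m [s2 [-> fc fl]]]]]]]] := IH vI wI vw.
by exists v', w'; split=> //; exists (a :: s1), c, m, s2.
Qed.

(** Prepending [x] as a fictitious predecessor makes the first vertex of [s] count as a successor:
    placing [x] in front of it needs no further edge. *)
Definition succs_nbr e x s := succs (fun u => (u == x) || e x u) (x :: s).

(* The path  .. a v .. c w ..  is rerouted as  .. a x c .. v m w .. *)
Lemma reroute e x s v w m : symmetric e -> sorted e s -> x \notin s ->
  v \in succs_nbr e x s -> w \in succs_nbr e x s -> v != w ->
  path e v (rcons m w) -> path e w (rcons m v) ->
  exists2 s', perm_eq s' (m ++ x :: s) & sorted e s'.
Proof.
move=> se ss xN vI wI vw pvw pwv.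
have [v' [w' [vwE [s1 [a [r [s2 [sE fa fl]]]]]]]] := succs_order vI wI vw.
have {pvw pwv vwE} pm : path e v' (rcons m w').
  by case: vwE => [[-> ->]|[-> ->]].
have revE : rev (v' :: r) = last v' r :: rev (belast v' r).
  by rewrite [v' :: r]lastI rev_rcons.
have lx : last v' r != x.
  apply: contraNneq xN => <-; have: last v' r \in v' :: r by rewrite mem_last.
  have sub : {subset (v' :: r) ++ w' :: s2 <= s}.
    by case: s1 sE => [|y s1] [_ ->] // z zI; rewrite mem_cat in_cons zI !orbT.
  by move=> lI; apply: sub; rewrite mem_cat lI.
have xl : e x (last v' r) by move: fl; rewrite (negbTE lx).
have join : sorted e ((v' :: r) ++ w' :: s2) ->
    path e x (rev (v' :: r) ++ m ++ w' :: s2).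
  rewrite /= cat_path /= => /and3P[pr _ pw].
  rewrite cat_path; apply/andP; split.
    apply: path_sorted_head; first by rewrite revE => b s' [<- _].
    by rewrite sorted_rev.
  by rewrite rev_cons last_rcons -cat_rcons cat_path pm last_rcons.
(* If [s1] is empty, [a] is the fictitious predecessor: [v'] begins [s] and the new path begins with
   [x]. *)
case: s1 sE => [|y s1] [yE sE].
  exists (x :: rev (v' :: r) ++ m ++ w' :: s2).
    by rewrite sE; perm_count.
  by apply: join; move: ss; rewrite sE.
exists (s1 ++ a :: x :: rev (v' :: r) ++ m ++ w' :: s2).
  by rewrite sE; perm_count.
move: ss fa; rewrite sE !sorted_cat_cons => /andP[-> /path_sorted/join p1].
have ax : a != x.
  by apply: contraNneq xN => <-; rewrite sE mem_cat inE eqxx orbT.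
by rewrite (negbTE ax) /= se => ->.
Qed.

End Sequences.

(** * Two graphs covering a vertex set: inserting a vertex into a path *)

Section PathsInSet.

Variable T : finType.
Implicit Types (e : rel T) (A B : {set T}) (s : seq T).

Definition path_in e A s := [&& uniq s, sorted e s & all (mem A) s].

Definition covers e1 e2 A :=
  {in A &, forall u v, u != v -> e1 u v || e2 u v}.

Definition degree e A x := #|[set v in A | (v != x) && e x v]|.

Lemma path_inP e A s : path_in e A s ->
  [/\ uniq s, sorted e s & {subset s <= A}].
Proof. by case/and3P => us ss /allP sA. Qed.

Lemma perm_path_in e A s s' : perm_eq s s' -> uniq s' -> {subset s' <= A} ->
  sorted e s -> path_in e A s.
Proof.
move=> ps us sA ss; rewrite /path_in ss (perm_uniq ps) us /=.
by apply/allP => z; rewrite (perm_mem ps) => /sA.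
Qed.

Lemma coversC e1 e2 A : covers e1 e2 A -> covers e2 e1 A.
Proof. by move=> c u v uA vA uv; rewrite orbC c. Qed.

(** An [e1]-edge inside [K] would bring [x] into [s]: directly if it contains [x], otherwise by
    [reroute] with [m] empty. The last vertex of [s] is no neighbour of [x], so every neighbour has
    a successor; the other two elements of [K] are [x] and the first vertex of [s]. By [covers], [K]
    is a clique of [e2]. *)
Lemma clique_succs e1 e2 A s x : symmetric e1 -> covers e1 e2 A ->
  path_in e1 A s -> x \in A -> x \notin s ->
  (forall s', perm_eq s' (x :: s) -> ~~ sorted e1 s') ->
  let K : seq T := x :: succs_nbr e1 x s in
  [/\ uniq K, {subset K <= x :: s}, size K = (count (e1 x) s).+2 &
    {in K &, forall u v, u != v -> ~~ e1 u v}].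
Proof.
move=> se cov /path_inP[us ss sA] xA xN noham K.
have {}noham s' : perm_eq s' (x :: s) -> sorted e1 s' -> False.
  by move=> /noham/negP.
have sK : {subset succs_nbr e1 x s <= s}.
  exact: mem_subseq (succs_subseq _ _).
have nx u : u \in s -> (u == x) = false.
  by move=> us'; apply: contraNF xN => /eqP<-.
have xK v : v \in succs_nbr e1 x s -> ~~ e1 x v.
  case/mem_succs=> [[|y s1] [a [s2 [[_ sE] fa]]]]; apply/negP => xv.
    apply: (noham (x :: s)) => //.
    by move: ss; rewrite sE /= => ->; rewrite xv.
  apply: (noham (s1 ++ [:: a, x, v & s2])); first by rewrite sE; perm_count.
  move: ss fa; rewrite nx; last by rewrite sE mem_cat inE eqxx orbT.
  by rewrite sE !sorted_cat_cons /= (se a x) xv => /and3P[-> _ ->] ->.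
split=> [|z|| u v].
- rewrite cons_uniq (contraNN (@sK x)) //.
  exact: (subseq_uniq (succs_subseq _ (x :: s)) us).
- by rewrite !inE => /orP[->//|/sK->]; rewrite orbT.
- rewrite /= size_succs => [|s' a sE].
    by rewrite /= eqxx add1n; congr _.+2; apply: eq_in_count => u /nx->.
  apply/negP => fa; case: s' sE => [|y s'] [yE sE].
    by apply: (noham [:: x]) => //; rewrite sE.
  have aS : a \in s by rewrite sE mem_rcons inE eqxx.
  move: fa; rewrite nx //= => xa.
  apply: (noham (rcons s x)); first by rewrite perm_rcons.
  by rewrite sE -cats1 cat_rcons sorted_cat_cons -sE ss /= se xa.
rewrite !in_cons => /orP[/eqP->|uK] /orP[/eqP->|vK] uv.
- by rewrite eqxx in uv.
- exact: xK.
- by rewrite se; apply: xK.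
apply/negP => euv.
have [] := @reroute _ e1 x s u v [::] se ss xN uK vK uv; rewrite /= ?euv //.
by rewrite se euv.
Qed.

(* With h = |t| - g, the vertices of [take h r ++ succs (mem K) (drop h r)] have
   no e2-edge to t, as such an edge would insert t into r; there are |K| - g of
   them, more than the |K| - 2 e1-neighbours of x on s. *)
Lemma nonadjacent_outside e1 e2 A s x r g : symmetric e1 -> symmetric e2 ->
  covers e1 e2 A -> path_in e1 A s -> x \in A -> x \notin s ->
  (forall s', perm_eq s' (x :: s) -> ~~ sorted e1 s') ->
  path_in e2 A r -> x \notin r ->
  let K : seq T := x :: succs_nbr e1 x s in
  let t : seq T := [seq v <- K | v \notin r] in
  g <= 1 -> g < size t ->
  (forall r', path_in e2 A r' -> {subset r' <= r ++ t} ->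
     size r' <= size r + g) ->
  exists z, [/\ z \in r, z \notin s, {in t, forall y, ~~ e2 y z} &
    size t = g.+1 -> z \in succs_nbr e2 x r].
Proof.
move=> se1 se2 cov ps xA xN noham pr xNr K t g1 gt rmax.
have [us ss sA] := path_inP ps; have [ur sr rA] := path_inP pr.
have [uK sK szK cK] := clique_succs se1 cov ps xA xN noham.
rewrite -/K in uK sK szK cK.
have KA : {subset K <= A}.
  by move=> z /sK; rewrite inE => /orP[/eqP->|/sA].
have eK u v : u \in K -> v \in K -> u != v -> e2 u v.
  move=> uI vI uv; have := cov u v (KA u uI) (KA v vI) uv.
  by rewrite (negbTE (cK u v uI vI uv)).
have ut : uniq t by rewrite filter_uniq.
have tK y : y \in t -> (y \in K) && (y \notin r) by rewrite mem_filter andbC.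
have xt : x \in t by rewrite mem_filter xNr inE eqxx.
have tord y : y \in t -> exists t', [/\ perm_eq (rcons t' y) t &
    sorted e2 (rcons t' y)].
  move=> yt; exists (rem y t); have pt : perm_eq (rcons (rem y t) y) t.
    by rewrite perm_rcons perm_sym perm_to_rem.
  split=> //; apply: clique_sorted; first by rewrite (perm_uniq pt).
  move=> u v; rewrite !(perm_mem pt) => /tK/andP[uK' _] /tK/andP[vK' _].
  exact: eK.
(* If all of [t] can replace a segment [s2] of [r], then [rmax] forces [s2] to have at least
   [size t - g] vertices. *)
have long s1 s2 r' : r = s1 ++ s2 ++ r' ->
    forall q, perm_eq q (s1 ++ t ++ r') -> sorted e2 q ->
    size t <= size s2 + g.
  move=> rE q pq sq.
  have uq : uniq (s1 ++ t ++ r').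
    have /= : uniq (r ++ t).
      rewrite cat_uniq ur ut andbT /=; apply/hasPn => y /tK/andP[_].
      by [].
    rewrite rE -!catA uniq_catCA => /=; rewrite cat_uniq => /and3P[_ _].
    by rewrite (perm_uniq (s2 := s1 ++ t ++ r')) //; perm_count.
  have subq : {subset s1 ++ t ++ r' <= r ++ t}.
    by move=> y; rewrite rE !mem_cat => /or3P[->|->|->]; rewrite ?orbT.
  have qA : {subset s1 ++ t ++ r' <= A}.
    move=> y /subq; rewrite mem_cat => /orP[/rA//|/tK/andP[/KA]//].
  have qrt : {subset q <= r ++ t} by move=> y; rewrite (perm_mem pq) => /subq.
  have := rmax q (perm_path_in pq uq qA sq) qrt.
  rewrite (perm_size pq) rE !size_cat.
  by nat_lia.
pose h := size t - g.
have hr : h <= size r.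
  have [t' [pt st]] := tord x xt.
  have := long [::] r [::] (esym (cats0 r)) (rcons t' x) _ st.
  by rewrite cats0 /h => /(_ pt); nat_lia.
have rE : r = take h r ++ drop h r by rewrite cat_take_drop.
pose B := take h r ++ succs (mem K) (drop h r).
have takeB z : z \in take h r -> {in t, forall y, ~~ e2 y z}.
  move=> zI y yt; apply/negP => yz; move: rE.
  have szt := size_takel hr; case/splitPr: zI szt => p1 p2 szt.
  rewrite -catA cat_cons => rE; have [t' [pt st]] := tord y yt.
  have := long [::] p1 (z :: p2 ++ drop h r) rE
    (rcons t' y ++ z :: p2 ++ drop h r).
  rewrite /= perm_cat2r => /(_ pt).
  rewrite cat_rcons sorted_cat_cons st /= yz /=.
  move: sr; rewrite {1}rE sorted_cat_cons => /andP[_ ->] /(_ isT).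
  by move: szt gt; rewrite size_cat /= /h; nat_lia.
have dropB a z s1 s2 : drop h r = s1 ++ a :: z :: s2 -> a \in K ->
    {in t, forall y, ~~ e2 y z}.
  move=> dE aK y yt; apply/negP => yz; move: rE.
  rewrite dE; move: (take h r) => r1; rewrite -cat_rcons catA -rcons_cat => rE'.
  have [t' [pt st]] := tord y yt.
  have := long (rcons (r1 ++ s1) a) [::] (z :: s2) rE'
    (rcons (r1 ++ s1) a ++ rcons t' y ++ z :: s2).
  rewrite perm_cat2l perm_cat2r => /(_ pt); rewrite cat_rcons.
  rewrite sorted_cat_cons cat_path last_rcons /= yz.
  have -> /= : path e2 a (rcons t' y).
    apply: path_sorted_head st => b s' bE.
    have /tK/andP[bK bN] : b \in t by rewrite -(perm_mem pt) bE inE eqxx.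
    apply: eK => //; apply: contraNneq bN => <-.
    by rewrite rE' mem_cat mem_rcons inE eqxx.
  move: sr; rewrite rE' cat_rcons sorted_cat_cons /=.
  by move=> /and3P[-> _ ->] /(_ isT); rewrite leqNgt gt.
have memB z : z \in B -> (z \in r) /\ {in t, forall y, ~~ e2 y z}.
  rewrite mem_cat => /orP[zI|zI].
    by split; [exact: mem_take zI | exact: takeB].
  have [s1 [a [s2 [dE aK]]]] := mem_succs zI.
  split; last exact: dropB dE aK.
  by apply: (mem_drop (n0 := h)); rewrite dE mem_cat !inE eqxx !orbT.
have uB : uniq B.
  move: ur; rewrite {1}rE !cat_uniq => /and3P[-> /hasPn dis ud] /=.
  rewrite (subseq_uniq (succs_subseq _ _)) ?andbT; last first.
    by case: (drop h r) ud => //= ? ? /andP[].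
  apply/hasPn => z /(mem_subseq (succs_subseq _ _))/mem_behead; exact: dis.
(* The vertices of [K] on [r] lie beyond the first [h], being [e2]-neighbours of [x]. None of them
   ends [r], since [t] could be appended to it. So each contributes a successor, and there are
   [size K - size t] of them. *)
have szB : size B = size K - g.
  rewrite size_cat size_takel // size_succs; last first.
    move=> s' a dE; apply/negP => aK; have [t' [pt st]] := tord x xt.
    have [r1 r1E] : exists r1, r = rcons r1 a.
      by exists (take h r ++ s'); rewrite {1}rE dE rcons_cat.
    have := long r [::] [::] (esym (cats0 r)) (rcons r1 a ++ rcons t' x).
    rewrite cats0 -r1E perm_cat2l => /(_ pt).
    rewrite {1}r1E cat_rcons sorted_cat_cons -r1E sr /=.
    rewrite leqNgt gt => /(_ _)/negP[] //.
    apply: path_sorted_head st => b s'' bE.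
    have /tK/andP[bK bN] : b \in t by rewrite -(perm_mem pt) bE inE eqxx.
    apply: eK => //; apply: contraNneq bN => <-.
    by rewrite r1E mem_rcons inE eqxx.
  have -> : count (mem K) (drop h r) = count (mem K) r.
    rewrite [in RHS]rE count_cat; suff -> : count (mem K) (take h r) = 0 by [].
    apply/eqP; rewrite -leqn0 leqNgt -has_count; apply/hasPn => z zI.
    apply/negP => zK; have /negP[] := takeB z zI x xt.
    apply: eK => //; first by rewrite inE eqxx.
    by apply: contraNneq xNr => ->; apply: mem_take zI.
  have -> : count (mem K) r = count (mem r) K.
    rewrite -!size_filter; apply: perm_size; apply: uniq_perm.
    - exact: filter_uniq.
    - exact: filter_uniq.
    by move=> z; rewrite !mem_filter andbC.
  have := count_predC (mem r) K; rewrite -(size_filter (predC _)) -/t /h.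
  by nat_lia.
have [/hasP[z zB zN]|/hasPn allB] := boolP (has [predC s] B).
  have [zr zt] := memB z zB; exists z; split=> // tg.
  move: zB; rewrite mem_cat => /orP[zI|/mem_succs[s1 [a [s2 [dE aK]]]]].
    (* The prefix is then the first vertex of [r], which always belongs to [succs_nbr]. *)
    have h1 : h = 1 by rewrite /h tg subSnn.
    move: zI; rewrite h1; case: (r) => // b r'; rewrite /= take0 inE => /eqP->.
    by apply: (@succs_mem _ _ [::] x b r'); rewrite eqxx.
  rewrite /succs_nbr {1}rE dE catA -cat_cons; apply: succs_mem.
  rewrite eK ?orbT //; first by rewrite inE eqxx.
  by apply: contraNneq xNr => ->; rewrite rE dE !mem_cat inE eqxx !orbT.
have : size B <= size (filter (e1 x) s).
  apply: uniq_leq_size uB _ => z zB; have := allB z zB; rewrite /= negbK => zs.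
  have [zr zt] := memB z zB; rewrite mem_filter zs andbT.
  have := cov x z xA (sA z zs) _; rewrite (negbTE (zt x xt)) orbF; apply.
  by apply: contraNneq xN => ->.
by rewrite szB size_filter szK => le; exfalso; nat_lia.
Qed.

(** If [r] missed a further vertex [y] of the clique, the [z] of [nonadjacent_outside] would be an
    [e1]-neighbour of both [x] and [y], and [x], [z] could be inserted into [s] just before [y],
    making it longer by 2. Allowing [(size s).+1] for [e1] and both values of [g] lets
    [insert_vertex] use this twice, with the graphs exchanged the second time. *)
Lemma clique_missed_le1 e1 e2 A s x r g : symmetric e1 -> symmetric e2 ->
  covers e1 e2 A -> path_in e1 A s -> x \in A -> x \notin s ->
  (forall s', perm_eq s' (x :: s) -> ~~ sorted e1 s') ->
  (forall s', path_in e1 A s' -> size s' <= (size s).+1) ->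
  path_in e2 A r -> x \notin r -> g <= 1 ->
  (forall r', path_in e2 A r' -> size r' <= size r + g) ->
  size [seq v <- x :: succs_nbr e1 x s | v \notin r] <= 1.
Proof.
move=> se1 se2 cov ps xA xN noham smax pr xNr g1 rmax.
rewrite leqNgt; apply/negP => t2.
have [|z [zr zN zt _]] := nonadjacent_outside se1 se2 cov ps xA xN noham pr
  xNr g1 (leq_ltn_trans g1 t2); first by move=> r' /rmax.
have [us ss sA] := path_inP ps; have [ur sr rA] := path_inP pr.
have [uK sK _ _] := clique_succs se1 cov ps xA xN noham.
have zx : z != x by apply: contraNneq xNr => <-.
have zA := rA z zr.
have nbr y : y \in x :: succs_nbr e1 x s -> y \notin r -> e1 y z.
  move=> yK yN; have yA : y \in A.
    by have := sK y yK; rewrite inE => /orP[/eqP->|/sA].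
  have := cov y z yA zA _; rewrite (negbTE (zt y _)) ?mem_filter ?yN // orbF.
  by apply; apply: contraNneq yN => ->.
have [y yt yx] : exists2 y, y \in [seq v <- x :: succs_nbr e1 x s | v \notin r]
    & y != x.
  apply/hasP; rewrite -[has _ _]negbK; apply/negP => /hasPn allx.
  have : size [seq v <- x :: succs_nbr e1 x s | v \notin r] <= size [:: x].
    apply: uniq_leq_size; first by rewrite filter_uniq.
    by move=> y /allx; rewrite negbK inE.
  by rewrite leqNgt t2.
move: yt; rewrite mem_filter => /andP[yN yK].
have yz := nbr y yK yN.
have xz : e1 x z by apply: nbr; rewrite // inE eqxx.
have uzxs : uniq (z :: x :: s) by rewrite /= inE negb_or zx zN xN.
have zxsA : {subset z :: x :: s <= A}.
  by move=> v; rewrite !inE => /or3P[/eqP->|/eqP->|/sA].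
have contra q : perm_eq q (z :: x :: s) -> sorted e1 q -> False.
  move=> pq sq; have := smax _ (perm_path_in pq uzxs zxsA sq).
  by rewrite (perm_size pq) /= ltnn.
move: yK; rewrite inE (negbTE yx) => /mem_succs[[|b s1] [a [s2 [[_ sE] fa]]]].
  apply: (contra (x :: z :: s)); first by perm_count.
  by move: ss; rewrite sE /= xz se1 yz => ->.
apply: (contra (s1 ++ [:: a, x, z, y & s2])); first by rewrite sE; perm_count.
have ax : (a == x) = false.
  by apply: contraNF xN => /eqP<-; rewrite sE mem_cat inE eqxx orbT.
move: ss fa; rewrite ax sE !sorted_cat_cons /= (se1 a x) xz (se1 z y) yz.
by move=> /and3P[-> _ ->] ->.
Qed.

(** Suppose that [x] cannot be inserted. By [clique_missed_le1], [r] misses only [x] of the clique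
    built on [s]. As no path uses all of [x :: r], [nonadjacent_outside] applies with [g = 0] and
    gives a [z] off [s] in [succs_nbr e2 x r]. Thus [s] misses both [x] and [z] of the clique built
    on [r], against [clique_missed_le1] with the graphs exchanged. *)
Lemma insert_vertex e1 e2 A s x r : symmetric e1 -> symmetric e2 ->
  covers e1 e2 A -> path_in e1 A s ->
  (forall s', path_in e1 A s' -> size s' <= size s) ->
  x \in A -> x \notin s -> path_in e2 A r -> x \notin r ->
  (forall r', path_in e2 A r' -> size r' <= (size r).+1) ->
  exists2 r', perm_eq r' (x :: r) & sorted e2 r'.
Proof.
move=> se1 se2 cov ps smax xA xN pr xNr rmax.
have [/hasP[q]|/hasPn noham2] :=
  boolP (has (sorted e2) (permutations (x :: r))).
  by rewrite mem_permutations; exists q.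
have [us ss sA] := path_inP ps; have [ur sr rA] := path_inP pr.
have noham1 s' : perm_eq s' (x :: s) -> ~~ sorted e1 s'.
  move=> ps'; apply/negP => ss'.
  suff /smax : path_in e1 A s' by rewrite (perm_size ps') /= ltnn.
  apply: perm_path_in ps' _ _ ss'; first by rewrite /= xN.
  by move=> v; rewrite inE => /orP[/eqP->|/sA].
have smax1 s' : path_in e1 A s' -> size s' <= (size s).+1.
  by move=> /smax/leq_trans; apply.
have szt :=
  clique_missed_le1 se1 se2 cov ps xA xN noham1 smax1 pr xNr (leqnn 1).
move: szt; set t := [seq v <- _ | _] => szt.
have {}szt : size t <= 1 by apply: szt => r' /rmax; rewrite addn1.
have xt : x \in t by rewrite mem_filter xNr inE eqxx.
have tE : t = [:: x].
  by case: t szt xt => [|y [|? ?]] //= _; rewrite inE => /eqP->.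
have [||z [_ zN _ zK]] := nonadjacent_outside se1 se2 cov ps xA xN noham1 pr xNr
  (leq0n 1).
- by rewrite -/t tE.
- move=> r' pr' sub; rewrite addn0 leqNgt; apply/negP => lt.
  have [ur' sr' r'A] := path_inP pr'.
  have sub' : {subset r' <= x :: r}.
    by move=> v /sub; rewrite -/t tE mem_cat !inE orbC.
  have [_ eqr] := uniq_min_size ur' sub' lt.
  have /noham2/negP[] // : r' \in permutations (x :: r).
  by rewrite mem_permutations uniq_perm //= xNr.
have {}zK : z \in succs_nbr e2 x r by apply: zK; rewrite -/t tE.
have noham2' r' : perm_eq r' (x :: r) -> ~~ sorted e2 r'.
  by rewrite -mem_permutations => /noham2.
have smax0 s' : path_in e1 A s' -> size s' <= size s + 0.
  by rewrite addn0; apply: smax.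
have := clique_missed_le1 se2 se1 (coversC cov) pr xA xNr noham2' rmax ps xN
  (leq0n 1) smax0.
set t' := [seq v <- _ | _] => szt'.
have : size [:: x; z] <= size t'.
  apply: uniq_leq_size => [|v].
    rewrite /= inE andbT; apply: contraNneq xNr => ->.
    exact: mem_subseq (succs_subseq _ _) _ zK.
  by rewrite !inE => /orP[]/eqP->;
    rewrite mem_filter ?xN ?zN inE ?eqxx ?zK ?orbT.
by rewrite /= leqNgt ltnS szt'.
Qed.

(** * Comparing a degree in one graph with a degree in the other *)

Lemma maximal_path e (U : {set T}) x l : path e x l -> uniq l ->
  {subset l <= U} -> exists l', [/\ path e x l', uniq l', {subset l' <= U},
    size l <= size l' & {in U, forall w, e (last x l') w -> w \in l'}].
Proof.
have [n] := ubnP (#|U| - size l); elim: n l => // n IH l ltn pl ul lU.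
have [/existsP[w /and3P[wU lw wN]]|] :=
  boolP [exists w, [&& w \in U, e (last x l) w & w \notin l]]; last first.
  rewrite negb_exists => /forallP noext; exists l; split=> // w wU lw.
  by have := noext w; rewrite wU lw negbK.
have ulw : uniq (rcons l w) by rewrite rcons_uniq wN.
have lwU : {subset rcons l w <= U}.
  by move=> v; rewrite mem_rcons inE => /orP[/eqP->|/lU].
have szU : size (rcons l w) <= #|U|.
  rewrite -(card_uniqP ulw); apply: subset_leq_card.
  by apply/subsetP => v /lwU.
have [||l' [pl' ul' l'U sz max]] := IH (rcons l w) _ _ ulw lwU.
- by move: szU ltn; rewrite size_rcons; nat_lia.
- by rewrite rcons_path pl.
exists l'; split=> //; rewrite size_rcons in sz; exact: ltnW.
Qed.

Lemma degree_ge e A x s : uniq s ->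
  (forall v, v \in s -> [/\ v \in A, v != x & e x v]) -> size s <= degree e A x.
Proof.
move=> us sN; rewrite -(card_uniqP us); apply: subset_leq_card.
by apply/subsetP => v /sN[vA vx xv]; rewrite inE vA vx.
Qed.

Lemma degree_le e A x s :
  (forall v, v \in A -> v != x -> e x v -> v \in s) -> degree e A x <= size s.
Proof.
move=> sN; apply: leq_trans (card_size s); apply: subset_leq_card.
by apply/subsetP => v; rewrite inE => /and3P[vA vx xv]; apply: sN.
Qed.

Lemma count_gt1_witnesses (s : seq T) (f : pred T) : uniq s -> 1 < count f s ->
  exists v w, [/\ v \in s, w \in s, f v, f w & v != w].
Proof.
move=> us; rewrite -size_filter; have := filter_uniq f us.
case E : (filter f s) => [|v [|w l]] //= /andP[vN _] _.
have vI : v \in filter f s by rewrite E inE eqxx.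
have wI : w \in filter f s by rewrite E !inE eqxx orbT.
move: vI wI; rewrite !mem_filter => /andP[fv vs] /andP[fw ws].
by exists v, w; split=> //; move: vN; rewrite inE negb_or => /andP[].
Qed.

(** The list [succs_nbr e2 u r] has one element more than [u] has [e2]-neighbours on [r]. At most
    one of its elements is an [e2]-neighbour of [x], since two would allow [reroute] with [m =
    [:: x]] to bring both [u] and [x] into [r]. The others, and all of [U], are [e1]-neighbours of
    [x], while off [r] the vertex [u] has at most the neighbours [U :\ u]. *)
Lemma smaller_degree_isolated e1 e2 A x r u : symmetric e1 -> symmetric e2 ->
  covers e1 e2 A -> x \in A -> path_in e2 A r -> x \notin r ->
  (forall r', path_in e2 A r' -> size r' <= (size r).+1) ->
  (forall r', perm_eq r' (u :: r) -> ~~ sorted e2 r') ->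
  u \in A -> u \notin r -> u != x ->
  {in A, forall w, w \notin r -> w != x -> ~~ e2 x w} ->
  degree e2 A u < degree e1 A x.
Proof.
move=> se1 se2 cov xA pr xNr rmax noham uA uNr ux iso.
have [ur sr rA] := path_inP pr.
pose U := [set w in A | (w \notin r) && (w != x)].
have uU : u \in U by rewrite inE uA uNr.
have [uB sB szB _] := clique_succs se2 (coversC cov) pr uA uNr noham.
have {}uB : uniq (succs_nbr e2 u r) by move: uB => /= /andP[].
have {}szB : size (succs_nbr e2 u r) = (count (e2 u) r).+1 by case: szB.
have {}sB : {subset succs_nbr e2 u r <= r}.
  exact: mem_subseq (succs_subseq _ _).
have cnt : count (e2 x) (succs_nbr e2 u r) <= 1.
  rewrite leqNgt; apply/negP.
  move=> /(count_gt1_witnesses uB)[v [w [vI wI xv xw vw]]].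
  have [] := @reroute _ e2 u r v w [:: x] se2 sr uNr vI wI vw.
  - by rewrite /= se2 xv xw.
  - by rewrite /= se2 xw xv.
  move=> q pq sq; suff /rmax : path_in e2 A q by rewrite (perm_size pq) /= ltnn.
  apply: perm_path_in pq _ _ sq.
    by rewrite /= inE negb_or eq_sym ux xNr uNr.
  by move=> y; rewrite !inE => /or3P[/eqP->|/eqP->|/rA].
have le : degree e2 A u <= size (filter (e2 u) r ++ enum (U :\ u)).
  apply: degree_le => v vA vu uv; rewrite mem_cat mem_filter uv /=.
  case vr : (v \in r) => //=; rewrite mem_enum !inE vu vA vr /=.
  by apply: contraTneq uv => ->; rewrite se2 iso.
have ge : size (enum U ++ filter (predC (e2 x)) (succs_nbr e2 u r))
    <= degree e1 A x.
  have nbr v : v \in A -> v != x -> ~~ e2 x v ->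
      [/\ v \in A, v != x & e1 x v].
    move=> vA vx xv; have := cov x v xA vA.
    by rewrite (negbTE xv) orbF eq_sym => ->.
  apply: degree_ge.
    rewrite cat_uniq enum_uniq filter_uniq // andbT; apply/hasPn => v.
    by rewrite mem_filter => /andP[_ /sB vr]; rewrite /= mem_enum inE vr andbF.
  move=> v; rewrite mem_cat mem_enum mem_filter inE.
  move=> /orP[/and3P[vA vr vx]|/andP[xv /sB vr]]; apply: nbr => //.
  - exact: iso.
  - exact: rA.
  - by apply: contraNneq xNr => <-.
move: le ge; rewrite !size_cat -!cardE !size_filter (cardsD1 u U) uU.
have := count_predC (e2 x) (succs_nbr e2 u r); rewrite szB.
by nat_lia.
Qed.

(** The path [x :: l] can be inserted into [r] in either direction, and the bound on path sizes
    forbids this. So the [e2]-edges from its end [u] to [r] exclude [e2]-edges from [x] to nearby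
    vertices of [r], and the vertices so excluded, [e1]-neighbours of [x], outnumber the
    [e2]-neighbours of [u]. *)
Lemma smaller_degree_joined e1 e2 A x r l y r1 r2 q1 q2 :
  symmetric e2 -> covers e1 e2 A -> x \in A ->
  path_in e2 A r -> x \notin r ->
  (forall r', path_in e2 A r' -> size r' <= (size r).+1) ->
  0 < size l -> path e2 x l -> uniq l -> x \notin l -> {subset l <= A} ->
  {in r, forall w, w \notin l} ->
  {in A, forall w, w \notin r -> w != x -> e2 (last x l) w -> w \in l} ->
  r = r1 ++ y :: r2 ->
  perm_eq (q1 ++ [:: x, y & q2]) (x :: r) ->
  sorted e2 (q1 ++ [:: x, y & q2]) ->
  degree e2 A (last x l) < degree e1 A x.
Proof.
move=> se2 cov xA pr xNr rmax l0 pl ul xNl lA dis lmax rE pq sq.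
have [ur sr rA] := path_inP pr.
set u := last x l.
have uN : u \notin r.
  apply/negP => ur'; have := mem_last x l.
  rewrite -/u inE (negbTE (dis u ur')) orbF => /eqP ux.
  by rewrite -ux ur' in xNr.
have revE : rev (x :: l) = u :: rev (belast x l).
  by rewrite [x :: l]lastI rev_rcons.
have uxlr : uniq ((x :: l) ++ r).
  rewrite cat_uniq /= xNl ul ur !andbT; apply/hasPn => w wr.
  rewrite /= inE negb_or dis // andbT.
  by apply: contraNneq xNr => <-.
have xlrA : {subset (x :: l) ++ r <= A}.
  by move=> w; rewrite mem_cat inE => /orP[/orP[/eqP->|/lA]|/rA].
have short t1 t2 t3 q : r = t1 ++ t2 ++ t3 ->
    perm_eq q (t1 ++ (x :: l) ++ t3) -> sorted e2 q -> size l <= size t2.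
  move=> tE pq' sq'; suff /rmax : path_in e2 A q.
    by rewrite (perm_size pq') tE !size_cat /=; nat_lia.
  apply: perm_path_in pq' _ _ sq'.
    have : uniq (t2 ++ t1 ++ (x :: l) ++ t3).
      rewrite (perm_uniq (s2 := (x :: l) ++ r)) // tE; by perm_count.
    by rewrite cat_uniq => /and3P[].
  move=> w wI; apply: xlrA; move: wI; rewrite tE !mem_cat.
  by case/or3P => ->; rewrite ?orbT.
have sl : sorted e2 (rev (x :: l)) by rewrite sorted_rev.
have pathx a t : e2 a x -> path e2 u t -> path e2 a ((x :: l) ++ t).
  by move=> ax; rewrite cat_path /= ax pl.
have pathu a t : e2 a u -> path e2 x t -> path e2 a (rev (x :: l) ++ t).
  move=> au pt; rewrite cat_path rev_cons last_rcons pt andbT -rev_cons.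
  by apply: path_sorted_head sl => b s'; rewrite revE => -[<-].
have insux t1 a z t3 : r = t1 ++ a :: z :: t3 -> e2 a u -> ~~ e2 x z.
  move=> tE au; apply/negP => xz; move: sr; rewrite tE sorted_cat_cons /=.
  case/and3P => s1 _ pz.
  have := short (rcons t1 a) [::] (z :: t3)
    (t1 ++ a :: rev (x :: l) ++ z :: t3).
  rewrite cat_rcons tE => /(_ erefl); rewrite leqNgt l0 => /(_ _ _)/notF[] //.
    by perm_count.
  by rewrite sorted_cat_cons s1 pathu //= xz.
have insxu t1 a z t3 : r = t1 ++ a :: z :: t3 -> e2 a x -> ~~ e2 u z.
  move=> tE ax; apply/negP => uz; move: sr; rewrite tE sorted_cat_cons /=.
  case/and3P => s1 _ pz.
  have := short (rcons t1 a) [::] (z :: t3) (t1 ++ a :: (x :: l) ++ z :: t3).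
  rewrite cat_rcons tE => /(_ erefl); rewrite leqNgt l0 => /(_ _ _)/notF[] //.
    by perm_count.
  by rewrite sorted_cat_cons s1 pathx //= uz.
have endx t1 a : r = rcons t1 a -> ~~ e2 a x.
  move=> tE; apply/negP => ax.
  have := short r [::] [::] (r ++ x :: l).
  rewrite !cats0 => /(_ erefl (perm_refl _)).
  rewrite leqNgt l0 => /(_ _)/notF[] //.
  rewrite tE cat_rcons sorted_cat_cons -tE sr.
  by have := pathx a [::] ax; rewrite cats0; apply.
have begx t1 z t3 : r = t1 ++ z :: t3 -> e2 x z -> size l <= size t1.
  move=> tE xz.
  apply: (short [::] t1 (z :: t3) (rev (x :: l) ++ z :: t3)) => //.
    by perm_count.
  rewrite rev_cons cat_rcons sorted_cat_cons -rev_cons sl /= xz.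
  by move: sr; rewrite tE sorted_cat_cons => /andP[].
have begu t1 z t3 : r = t1 ++ z :: t3 -> e2 u z -> size l <= size t1.
  move=> tE uz; apply: (short [::] t1 (z :: t3) ((x :: l) ++ z :: t3)) => //.
  rewrite /= cat_path pl /= uz.
  by move: sr; rewrite tE sorted_cat_cons => /andP[].
have xy : e2 x y by move: sq; rewrite sorted_cat_cons /= => /and3P[].
(* The vertices [x] and [y] are consecutive on the given path through [x :: r]; an edge from [u] to
   [y] would fit [l] between them. *)
have uy : ~~ e2 u y.
  apply/negP => uy; move: sq; rewrite sorted_cat_cons /= => /and3P[sq1 _ pq2].
  have := short r [::] [::] (q1 ++ (x :: l) ++ y :: q2).
  rewrite !cats0 => /(_ erefl); rewrite leqNgt l0 => /(_ _ _)/notF[] //.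
    move/permP: pq => pq; apply/permP => f; have := pq f.
    by rewrite /= !count_cat /= !count_cat /=; move: (count f q1) (f x : nat)
      (f y : nat) (count f q2) (count f r) (count f l); clear; lia.
  rewrite sorted_cat_cons sq1 cat_path pl /=.
  by rewrite -/u uy.
have k1 : size l <= size r1 := begx r1 y r2 rE xy.
have le : degree e2 A u <= size (filter (e2 u) r ++ belast x l).
  apply: degree_le => v vA vu uv; rewrite mem_cat mem_filter uv /=.
  case vr : (v \in r) => //=.
  have : v \in x :: l.
    by rewrite inE; case vx : (v == x) => //=; apply: lmax; rewrite ?vr ?vx.
  by rewrite [x :: l]lastI mem_rcons inE (negbTE vu).
(* An edge from [x] into [B1] would let [x :: l] replace the fewer than [size l] vertices before it.
   [B2] holds successors of neighbours of [u]; [B3], read along the reversed [r2], holds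
   predecessors of such neighbours and the last vertex of [r]. That last vertex supplies the extra 1
   over the bound [le]. *)
pose B1 := take (size l) r1.
pose B2 := succs (e2 u) (drop (size l) r1).
pose B3 := succs_nbr e2 u (rev r2).
have r1E : r1 = B1 ++ drop (size l) r1 by rewrite cat_take_drop.
have subB1 : {subset B1 <= r1} by move=> w; apply: mem_take.
have subB2 : {subset B2 <= drop (size l) r1}.
  by move=> w /(mem_subseq (succs_subseq _ _))/mem_behead.
have subB3 : {subset B3 <= r2}.
  by move=> w /(mem_subseq (succs_subseq _ _)); rewrite mem_rev.
have B123r : {subset B1 ++ B2 ++ B3 <= r}.
  move=> w; rewrite (mem_cat w B1) (mem_cat w B2).
  move=> /or3P[/subB1|/subB2/mem_drop|/subB3] wr;
    by rewrite rE mem_cat inE wr ?orbT.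
have uB : uniq (B1 ++ B2 ++ B3).
  have : uniq (B1 ++ drop (size l) r1 ++ y :: r2) by rewrite catA -r1E -rE.
  rewrite cat_uniq => /and3P[u1 /hasPn d1].
  rewrite cat_uniq => /and3P[u2 /hasPn d2 /= /andP[_ u3]].
  rewrite cat_uniq u1 andTb; apply/andP; split.
    apply/hasPn => w; rewrite (mem_cat w B2) => /orP[/subB2|/subB3] wI;
      by apply: d1; rewrite mem_cat inE wI ?orbT.
  rewrite (cat_uniq B2); apply/and3P; split.
  - apply: subseq_uniq (succs_subseq _ _) _.
    by case: (drop _ r1) u2 => //= ? ? /andP[].
  - apply/hasPn => w /subB3 wI; apply: contra (d2 w _); first exact: subB2.
    by rewrite inE wI orbT.
  - by apply: subseq_uniq (succs_subseq _ _) _; rewrite /= rev_uniq.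
have nbr v : v \in B1 ++ B2 ++ B3 -> ~~ e2 x v.
  rewrite (mem_cat v B1) (mem_cat v B2).
  move=> /or3P[vB|/mem_succs[s1 [a [s2 [dE ua]]]]|].
  - apply/negP => xv; have := size_takel k1; rewrite -/B1.
    move: r1E; case/splitPr: vB => p1 p2 r1E.
    have := begx p1 v (p2 ++ drop (size l) r1 ++ y :: r2) _ xv.
    rewrite rE {1}r1E -!catA => /(_ erefl); rewrite size_cat /=; nat_lia.
  - apply: (insux (B1 ++ s1) a v (s2 ++ y :: r2)); last by rewrite se2.
    by rewrite rE r1E dE -!catA.
  case/mem_succs=> [[|b s1] [a [s2 [[_ sE] fa]]]].
    have r2E : r2 = rcons (rev s2) v by rewrite -rev_cons -sE revK.
    rewrite se2; apply: (endx (r1 ++ y :: rev s2)).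
    by rewrite rE r2E -cats1 -[RHS]cats1 -catA.
  have r2E : r2 = rev s2 ++ [:: v, a & rev s1].
    by rewrite -[r2]revK sE rev_cat !rev_cons -!cats1 -!catA.
  apply/negP => xv; have := insxu (r1 ++ y :: rev s2) v a (rev s1).
  rewrite rE r2E -catA /= => /(_ erefl); rewrite se2 xv => /(_ isT).
  case/orP: fa => [/eqP au|->//].
  by case/negP: uN; rewrite -au rE r2E !(mem_cat, inE) eqxx !orbT.
have ge : size (B1 ++ B2 ++ B3) <= degree e1 A x.
  apply: degree_ge => // v vB; have vr := B123r v vB.
  have vx : v != x by apply: contraNneq xNr => <-.
  split; rewrite ?rA //; have := cov x v xA (rA v vr).
  by rewrite (negbTE (nbr v vB)) orbF eq_sym => ->.
(* No neighbour of [u] is lost: none lies in [B1], and none ends [r1], as [x :: l] reversed would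
   then fit before [y]. *)
have szB2 : size B2 = count (e2 u) r1.
  rewrite /B2 size_succs => [|s' a dE].
    rewrite [in RHS]r1E count_cat; suff -> : count (e2 u) B1 = 0 by [].
    apply/eqP; rewrite -leqn0 leqNgt -has_count; apply/hasPn => v vB.
    apply/negP => uv; have := size_takel k1; rewrite -/B1.
    move: r1E; case/splitPr: vB => p1 p2 r1E.
    have := begu p1 v (p2 ++ drop (size l) r1 ++ y :: r2) _ uv.
    by rewrite rE {1}r1E -!catA => /(_ erefl); rewrite size_cat /=; nat_lia.
  apply/negP => ua; move: xy; apply/negP; apply: (insux (B1 ++ s') a y r2).
    by rewrite rE {1}r1E dE -cats1 -!catA.
  by rewrite se2.
(* Since [x] is joined to [y], [y] does not end [r], and the first vertex of [r2] is no neighbour of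
   [u]: otherwise [x :: l] would fit after [y]. *)
have szB3 : size B3 = (count (e2 u) r2).+1.
  rewrite /B3 size_succs => [|s' a dE].
    rewrite /= eqxx count_rev; congr _.+1; apply: eq_in_count => w wI.
    have -> // : (w == u) = false.
    by apply: contraNF uN => /eqP<-; rewrite rE mem_cat inE wI !orbT.
  case: s' dE => [|b s'] [bE r2E].
    have := endx r1 y; rewrite se2 xy => /(_ _)/notF[].
    by rewrite rE -[r2]revK r2E cats1.
  have {}r2E : r2 = a :: rev s' by rewrite -[r2]revK r2E rev_rcons.
  rewrite negb_or; apply/andP; split.
    by apply: contraNneq uN => <-; rewrite rE r2E mem_cat !inE eqxx !orbT.
  by apply: (insxu r1 y a (rev s')); rewrite ?rE ?r2E // se2.
move: le ge; rewrite (size_cat B1) (size_cat B2) szB2 szB3 size_takel //.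
rewrite size_cat size_filter rE count_cat /= (negbTE uy) size_belast.
by nat_lia.
Qed.

(** Here [q] is [r] with [x] inserted. If [x] has an [e2]-neighbour outside [r], then [u] is the end
    of a maximal path that leaves [x] outside [r]; if not, [u] is any remaining vertex outside
    [r]. *)
Lemma smaller_degree e1 e2 A s x r : symmetric e1 -> symmetric e2 ->
  covers e1 e2 A -> path_in e1 A s ->
  (forall s', path_in e1 A s' -> size s' <= size s) ->
  x \in A -> x \notin s -> path_in e2 A r -> x \notin r ->
  (forall r', path_in e2 A r' -> size r' <= (size r).+1) ->
  (size r).+1 < #|A| ->
  exists u q, [/\ path_in e2 A q, size q = (size r).+1, u \in A, u \notin q &
    degree e2 A u < degree e1 A x].
Proof.
move=> se1 se2 cov ps smax xA xN pr xNr rmax rA1.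
have [ur sr rA] := path_inP pr.
have uxr : uniq (x :: r) by rewrite /= xNr.
have xrA : {subset x :: r <= A} by move=> v; rewrite inE => /orP[/eqP->|/rA].
have [q pq sq] := insert_vertex se1 se2 cov ps smax xA xN pr xNr rmax.
have qI := perm_path_in pq uxr xrA sq.
have szq : size q = (size r).+1 by rewrite (perm_size pq).
(* A path of this size missing [x] could take in [x] by [insert_vertex], against [rmax]. Hence no
   path uses exactly the vertices of [u :: r]. *)
have cover_x q' : path_in e2 A q' -> size q' = (size r).+1 -> x \in q'.
  move=> q'I szq'; apply/negPn/negP => xq'.
  have [uq' _ q'A] := path_inP q'I.
  have [|q'' pq'' sq''] := insert_vertex se1 se2 cov ps smax xA xN q'I xq'.
    by move=> r' /rmax; rewrite szq' => /leqW.
  suff /rmax : path_in e2 A q'' by rewrite (perm_size pq'') /= szq' ltnn.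
  apply: perm_path_in pq'' _ _ sq''; first by rewrite /= xq'.
  by move=> v; rewrite inE => /orP[/eqP->|/q'A].
pose U := [set w in A | (w \notin r) && (w != x)].
have UP u : u \in U -> [/\ u \in A, u \notin r & u != x].
  by rewrite inE => /and3P[].
have notq u : u \in U -> u \notin q.
  by move=> /UP[_ ur' ux]; rewrite (perm_mem pq) inE negb_or ux.
have [/existsP[w /and4P[wA wr wx xw]]|] := boolP [exists w, [&& w \in A,
    w \notin r, w != x & e2 x w]].
  have wU : w \in U by rewrite inE wA wr.
  have [||v|l [pl ul lU szl lmax]] := maximal_path (e := e2) (U := U)
    (x := x) (l := [:: w]).
  - by rewrite /= xw.
  - by [].
  - by rewrite inE => /eqP->.
  rewrite /= in szl; have xNl : x \notin l by apply/negP => /lU/UP[_ _ /eqP].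
  have ulU : last x l \in U.
    by case: (l) szl lU => //= a l' _; apply; apply: mem_last.
  exists (last x l), q; split=> //; first by have [] := UP _ ulU.
    exact: notq.
  have xq : x \in q by rewrite (perm_mem pq) inE eqxx.
  (* If [x] ended [q], then [l] could be appended; so [x] has a successor [y]. *)
  case/splitPr: xq pq sq => q1 [|y q2] pq sq.
    suff /rmax : path_in e2 A (q1 ++ x :: l).
      by move: (perm_size pq); rewrite !size_cat /=; nat_lia.
    have pq' : perm_eq (q1 ++ x :: l) ((x :: r) ++ l).
      by rewrite -cat_rcons -cats1 perm_cat2r.
    apply: perm_path_in pq' _ _ _.
    - rewrite cat_uniq uxr ul andbT; apply/hasPn => v /lU/UP[_ vr vx].
      by rewrite /= inE negb_or vx.
    - by move=> v; rewrite mem_cat => /orP[/xrA|/lU/UP[]].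
    by move: sq; rewrite !sorted_cat_cons /= => /andP[-> _].
  have yr : y \in r.
    have : uniq (q1 ++ [:: x, y & q2]) by rewrite (perm_uniq pq).
    rewrite cat_uniq /= !inE => /and3P[_ _ /and3P[/norP[xy _] _ _]].
    have := perm_mem pq y; rewrite mem_cat !inE eqxx !orbT eq_sym (negbTE xy).
    by rewrite orFb => <-.
  have [r1 [r2 E]] : exists r1 r2, r = r1 ++ y :: r2.
    by case/splitPr: yr => r1 r2; exists r1, r2.
  apply: (smaller_degree_joined se2 cov xA pr xNr rmax szl pl ul xNl _ _ _ E
    pq sq).
  - by move=> v /lU/UP[].
  - by move=> v vr; apply/negP => /lU/UP[_]; rewrite vr.
  - by move=> v vA vr vx; apply: lmax; rewrite inE vA vr.
rewrite negb_exists => /forallP iso.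
have [u uU] : exists u, u \in U.
  apply/set0Pn; rewrite -card_gt0 lt0n; apply: contraTneq rA1 => U0.
  rewrite -leqNgt; have <- : #|[set v in x :: r]| = (size r).+1.
    by rewrite cardsE; apply/card_uniqP.
  apply: subset_leq_card; apply/subsetP => v vA; rewrite !inE.
  apply: contraT; rewrite negb_or => /andP[vx vr].
  by move/cards0_eq/setP/(_ v): U0; rewrite !inE vA vr vx.
have [uA ur' ux] := UP u uU; exists u, q; split=> //; first exact: notq.
apply: (smaller_degree_isolated se1 se2 cov xA pr xNr rmax) => //.
  move=> r' pr'; apply/negP => sr'.
  have r'I : path_in e2 A r'.
    apply: perm_path_in pr' _ _ sr'; first by rewrite /= ur'.
    by move=> v; rewrite inE => /orP[/eqP->|/rA].
  have := cover_x r' r'I; rewrite (perm_size pr') (perm_mem pr') inE.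
  by rewrite eq_sym (negbTE ux) (negbTE xNr) => /(_ erefl).
by move=> w wA wr wx; have := iso w; rewrite wA wr wx.
Qed.

(** * Longest paths within a vertex set *)

Definition longest e A :=
  \max_(m < #|T|.+1 | [exists s : m.-tuple T, path_in e A s]) m.

Lemma size_le_longest e A s : path_in e A s -> size s <= longest e A.
Proof.
move=> sI; have [us _ _] := path_inP sI.
have szs : size s < #|T|.+1 by rewrite ltnS -(card_uniqP us) max_card.
rewrite -[size s]/(nat_of_ord (Ordinal szs)); apply: leq_bigmax_cond.
by apply/existsP; exists (in_tuple s).
Qed.

Lemma longestP e A : exists2 s, path_in e A s & size s = longest e A.
Proof.
have n0 : [exists s : (ord0 : 'I_#|T|.+1).-tuple T, path_in e A s].
  by apply/existsP; exists [tuple].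
have [|m /existsP[s sI] mE] := eq_bigmax_cond (fun m : 'I_#|T|.+1 => m : nat)
  (_ : 0 < #|[pred m : 'I_#|T|.+1 | [exists s : m.-tuple T, path_in e A s]]|).
  by apply/card_gt0P; exists ord0.
by exists s; rewrite ?size_tuple // -mE; apply: eq_bigl.
Qed.

Lemma path_in_sub e A B s : A \subset B -> path_in e A s -> path_in e B s.
Proof.
move=> /subsetP AB /path_inP[us ss sA].
by apply: perm_path_in (perm_refl s) us _ ss => v /sA/AB.
Qed.

Lemma longest_sub e A B : A \subset B -> longest e A <= longest e B.
Proof.
move=> AB; have [s sI <-] := longestP e A.
exact: size_le_longest (path_in_sub AB sI).
Qed.

Lemma longest_card e A : longest e A <= #|A|.
Proof.
have [s sI <-] := longestP e A; have [us _ sA] := path_inP sI.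
rewrite -(card_uniqP us); apply: subset_leq_card.
by apply/subsetP => v /sA.
Qed.

Lemma longest_gt0 e A : 0 < #|A| -> 0 < longest e A.
Proof.
case/card_gt0P => x xA; apply: (size_le_longest (s := [:: x])).
by apply/and3P; split; rewrite //= andbT.
Qed.

Lemma path_inD1 e A x s :
  path_in e (A :\ x) s = path_in e A s && (x \notin s).
Proof.
apply/idP/andP => [sI|[/path_inP[us ss sA] xN]].
  split; first exact: path_in_sub (subsetDl _ _) sI.
  by have [_ _ sA] := path_inP sI; apply/negP => /sA; rewrite !inE eqxx.
apply: perm_path_in (perm_refl s) us _ ss => v vs.
by rewrite !inE sA // andbT; apply: contraNneq xN => <-.
Qed.

(** * Families of graphs covering in pairs: the vertex to delete and the bound on the deficits *)

Variables (I : eqType) (G : I -> rel T).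
Hypothesis Gsym : forall i, symmetric (G i).
Hypothesis Gcov : forall i j u v, i != j -> u != v -> G i u v || G j u v.

Definition missed A i x :=
  (x \in A) && (longest (G i) (A :\ x) == longest (G i) A).

Lemma missed_exists A i : longest (G i) A < #|A| -> exists x, missed A i x.
Proof.
have [s sI sL] := longestP (G i) A; have [us _ sA] := path_inP sI.
rewrite -sL -(card_uniqP us) => lt.
have [x xA xs] : exists2 x, x \in A & x \notin s.
  apply/subsetPn; apply: contraTN lt => As; rewrite -leqNgt.
  exact: subset_leq_card.
exists x; rewrite /missed xA eqn_leq longest_sub ?subsetDl //= -sL.
by apply: size_le_longest; rewrite path_inD1 sI.
Qed.

Lemma reducible_vertex A (s : seq I) : s != [::] -> uniq s ->
  {in s, forall i, longest (G i) A < #|A|} ->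
  exists j x, [/\ j \in s, x \in A &
    {in s, forall i, i != j -> (longest (G i) (A :\ x)).+2 <= longest (G i) A}].
Proof.
move=> s0 us lt.
pose P d :=
  has (fun j => [exists x, missed A j x && (degree (G j) A x == d)]) s.
have exP : exists d, P d.
  case: s s0 lt @P {us} => // j s _ lt P.
  have [x mx] := missed_exists (lt j (mem_head _ _)).
  exists (degree (G j) A x); rewrite /P /=; apply/orP; left.
  by apply/existsP; exists x; rewrite mx /=.
have [d /hasP[j js /existsP[x /andP[mx /eqP xd]]] dmin] := ex_minnP exP.
have /andP[xA /eqP xL] := mx.
exists j, x; split=> // i is' ij; rewrite ltnNge; apply/negP => Li.
have [p pI pL] := longestP (G j) (A :\ x).
have [q qI qL] := longestP (G i) (A :\ x).
move: pI qI; rewrite !path_inD1 => /andP[pI xp] /andP[qI xq].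
have pmax s' : path_in (G j) A s' -> size s' <= size p.
  by rewrite pL xL; apply: size_le_longest.
have qmax s' : path_in (G i) A s' -> size s' <= (size q).+1.
  by move=> /size_le_longest/leq_trans; apply; rewrite qL.
have cov : covers (G j) (G i) A.
  by move=> u v _ _; apply: Gcov; rewrite eq_sym.
have [q' pq' sq'] :=
  insert_vertex (Gsym j) (Gsym i) cov pI pmax xA xp qI xq qmax.
have q'L : (size q).+1 <= longest (G i) A.
  have [uq _ qA] := path_inP qI.
  rewrite -[_.+1]/(size (x :: q)) -(perm_size pq').
  apply: size_le_longest; apply: perm_path_in pq' _ _ sq'.
    by rewrite /= xq.
  by move=> v; rewrite inE => /orP[/eqP->|/qA].
have [u [r [rI rL uA ur du]]] := smaller_degree (Gsym j) (Gsym i) cov pI pmax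
  xA xp qI xq qmax (leq_ltn_trans q'L (lt i is')).
(* By [Li] the size of [r], which is [(size q).+1], reaches [longest (G i) A]; as [r] avoids [u],
   the pair [i], [u] competes in the minimum. *)
have : P (degree (G i) A u).
  apply/hasP; exists i => //; apply/existsP; exists u; rewrite eqxx andbT.
  rewrite /missed uA eqn_leq longest_sub ?subsetDl //=.
  apply: (@leq_trans (size r)); first by rewrite rL qL.
  by apply: size_le_longest; rewrite path_inD1 rI.
by move/dmin; rewrite -xd leqNgt du.
Qed.

(** Horner form of the sum with weights 1, 2, 4, ..., convenient for induction; [binary_sum_iota]
    restores the powers of 2. *)
Fixpoint binary_sum (m : seq nat) :=
  if m is a :: m' then a + 2 * binary_sum m' else 0.

Definition deficit A i := #|A| - longest (G i) A.

Lemma binary_sum_rcons0 m : binary_sum (rcons m 0) = binary_sum m.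
Proof. by elim: m => //= a m ->. Qed.

Lemma binary_sum_le (J : eqType) (f g : J -> nat) (s : seq J) :
  {in s, forall i, f i <= g i} ->
  binary_sum [seq f i | i <- s] <= binary_sum [seq g i | i <- s].
Proof.
elim: s => //= i s IH fg; rewrite leq_add ?fg ?mem_head // leq_mul2l IH //.
by move=> k ks; apply: fg; rewrite inE ks orbT.
Qed.

(** If [j] has weight [2 ^ k], a drop by 1 there costs [2 ^ k], and the entries before it gain at
    least the sum of the smaller weights, [2 ^ k - 1]. This is what the powers of 2 are for. *)
Lemma binary_sum_leS (J : eqType) (f g : J -> nat) (s : seq J) j : uniq s ->
  {in s, forall i, i != j -> f i < g i} -> f j <= (g j).+1 ->
  binary_sum [seq f i | i <- s] <= (binary_sum [seq g i | i <- s]).+1.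
Proof.
move=> us fg fgj; elim: s us fg => //= i s IH /andP[iN us] fg.
have fgs : {in s, forall k, k != j -> f k < g k}.
  by move=> k ks; apply: fg; rewrite inE ks orbT.
have [ij|ij] := eqVneq i j; last first.
  have := fg i (mem_head _ _) ij; have := IH us fgs.
  by nat_lia.
have : binary_sum [seq f k | k <- s] <= binary_sum [seq g k | k <- s].
  apply: binary_sum_le => k ks; apply: ltnW; apply: fgs => //.
  by apply: contraNneq iN => kj; rewrite ij -kj.
rewrite ij; nat_lia.
Qed.

Lemma deficit_bound A (s : seq I) : 0 < #|A| -> uniq s ->
  exists2 s', perm_eq s' s & binary_sum [seq deficit A i | i <- s'] < #|A|.
Proof.
have [n] := ubnP (#|A| + size s); elim: n A s => // n IH A s ltn A0 us.
have [->|s0] := eqVneq s [::]; first by exists [::].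
have [/hasP[i is' /eqP iL]|/hasPn full] :=
  boolP (has (fun i => longest (G i) A == #|A|) s).
  have [|s' ps' lt] := IH A (rem i s) _ A0 (rem_uniq i us).
    by rewrite size_rem //; case: (s) s0 ltn => //= *; lia.
  exists (rcons s' i).
    rewrite perm_sym (perm_trans (perm_to_rem is')) //.
    by rewrite perm_sym perm_rcons perm_cons.
  by rewrite map_rcons /deficit iL subnn binary_sum_rcons0.
have lt : {in s, forall i, longest (G i) A < #|A|}.
  by move=> i is'; rewrite ltn_neqAle longest_card full.
have [j [x [js xA red]]] := reducible_vertex s0 us lt.
have A1 : #|A| = #|A :\ x|.+1 by rewrite (cardsD1 x A) xA.
have A0' : 0 < #|A :\ x|.
  by have := lt j js; rewrite A1; have := longest_gt0 (G j) A0; lia.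
have [|s' ps' lt'] := IH (A :\ x) s _ A0' us.
  by move: ltn; rewrite A1.
have red' : {in s', forall i, i != j -> deficit A i < deficit (A :\ x) i}.
  move=> i; rewrite (perm_mem ps') /deficit A1 => is' ij.
  by have := red i is' ij; have := lt i is'; rewrite A1; nat_lia.
(* The same order serves: restoring [x] adds 1 to the cardinality and, by [binary_sum_leS], at most
   1 to the sum. *)
exists s'; rewrite // [leqRHS]A1 ltnS; apply: leq_trans lt'.
apply: binary_sum_leS red' _; first by rewrite (perm_uniq ps').
rewrite /deficit A1; have := longest_card (G j) (A :\ x).
by have := longest_sub (G j) (subsetDl A [set x]); nat_lia.
Qed.

End PathsInSet.

(** * Rearrangement of binary sums, and the final count *)

Lemma binary_sum_insert a m1 m2 : all (leq a) m1 ->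
  binary_sum (m1 ++ a :: m2) <= a + 2 * binary_sum (m1 ++ m2).
Proof.
by elim: m1 => //= b m1 IH /andP[ab /IH]; nat_lia.
Qed.

(** Rearrangement inequality. Moving the least entry to the front doubles the weights of the entries
    it passes, which compensates for its own loss of weight; the rest follows by induction. *)
Lemma binary_sum_sorted m m' : perm_eq m m' -> sorted leq m' ->
  binary_sum m <= binary_sum m'.
Proof.
elim: m' m => [|a m' IH] m pm sm'; first by move/perm_nilP: pm => ->.
have am : a \in m by rewrite (perm_mem pm) mem_head.
case/splitPr: am pm => m1 m2 pm.
have {}pm : perm_eq (m1 ++ m2) m'.
  by rewrite -(perm_cons a); apply: perm_trans pm; perm_count.
have := IH _ pm (path_sorted sm').
have : all (leq a) m1.
  have := order_path_min leq_trans sm'; rewrite -(perm_all _ pm) all_cat.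
  by case/andP.
by move=> /(binary_sum_insert m2) /=; lia.
Qed.

Lemma binary_sum_iota (f : nat -> nat) k n :
  binary_sum [seq f i | i <- iota k n] = \sum_(i < n) 2 ^ i * f (k + i).
Proof.
elim: n k => [|n IH] k; first by rewrite big_ord0.
rewrite big_ord_recl /= IH expn0 mul1n addn0; congr (_ + _).
rewrite big_distrr /=; apply: eq_bigr => i _.
by rewrite mulnA expnS addSnnS.
Qed.

(** The weights add up to [2 ^ size s - 1]; the summand [c] on the right avoids the subtraction. *)
Lemma binary_sum_pair (J : eqType) (f g : J -> nat) c (s : seq J) :
  {in s, forall i, c <= f i + g i} ->
  c * 2 ^ size s <=
    binary_sum [seq f i | i <- s] + binary_sum [seq g i | i <- s] + c.
Proof.
elim: s => [|i s IH] fg /=; first by rewrite expn0 muln1.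
have := fg i (mem_head _ _).
have : c * 2 ^ size s <=
    binary_sum [seq f i | i <- s] + binary_sum [seq g i | i <- s] + c.
  by apply: IH => k ks; apply: fg; rewrite inE ks orbT.
rewrite expnS mulnCA; move: (c * _) => X; nat_lia.
Qed.

Theorem theorem7 (t : nat) (l : nat -> nat)
    (ht : 3 <= t)
    (hl0 : 2 <= l 0)
    (hl : forall i : nat, i.+1 < t -> l i <= l i.+1)
    (hlt : l t.-1 < p t.-1 l) :
  p t l <= ((\sum_(i < t) 2 ^ i * l i) - 2) %/ (2 ^ t - 2).
Proof.
set S := \sum_(i < t) _; set n := _ %/ _.
have t1 : 1 < t by apply: leq_trans ht.
have [_ ->] // := p_least l t1.
have two_t : 2 < 2 ^ t.
  by apply: leq_trans (_ : 2 ^ 2 <= _) => //; rewrite leq_exp2l.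
have l2 i : i < t -> 2 <= l i.
  by elim: i => // i IH it; apply: leq_trans (hl i it); apply: IH; apply: ltnW.
have SE : S = binary_sum [seq l i | i <- iota 0 t] by rewrite binary_sum_iota.
have sorted_l : sorted leq [seq l i | i <- iota 0 t].
  rewrite sorted_map; apply/(sortedP 0) => i; rewrite size_iota => it.
  by rewrite !nth_iota ?add0n //= ?hl // ltnW.
(* From [l i >= 2] and the total weight [2 ^ t - 1]. It makes [n] positive, as [deficit_bound]
   requires, and keeps [S - 2] from being truncated. *)
have S2 : 2 * 2 ^ t <= S + 2.
  have /(binary_sum_pair (f := l) (g := fun=> 0)) :
      {in iota 0 t, forall i, 2 <= l i + 0}.
    by move=> i; rewrite mem_iota addn0 => /l2.
  rewrite size_iota -SE; suff -> : binary_sum [seq 0 | _ <- iota 0 t] = 0.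
    by rewrite addn0.
  by elim: (iota 0 t) => //= a m ->.
have n0 : 0 < n by rewrite divn_gt0; lia.
have nlt : S - 2 < n.+1 * (2 ^ t - 2) by apply: ltn_ceil; lia.
(* A colouring without the wanted paths is shown to give the opposite of [nlt]. *)
apply/forallP => c; apply: contraTT nlt => /existsPn none; rewrite -leqNgt.
pose G (i : 'I_t) (x y : 'I_n) := c [set x; y] != i.
have Gsym i : symmetric (G i) by move=> x y; rewrite /G setUC.
have Gcov i j u v : i != j -> u != v -> G i u v || G j u v.
  by rewrite /G => ij _; case: eqP => //= ->; rewrite ij.
have [||s ps] := deficit_bound Gsym Gcov (A := [set: 'I_n]) (s := enum 'I_t).
- by rewrite cardsT card_ord.
- exact: enum_uniq.
have short i : longest (G i) [set: 'I_n] < l i.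
  rewrite ltnNge; apply/negP => li.
  have [q /path_inP[uq sq _] qL] := longestP (G i) [set: 'I_n].
  have tP : size (take (l i) q) == l i by rewrite size_takel // qL.
  move/existsP: (none i); apply; exists (Tuple tP).
  by apply/andP; split; [exact: take_uniq | exact: take_sorted].
rewrite cardsT card_ord.
have /binary_sum_pair : {in s, forall i : 'I_t,
    n.+1 <= deficit G [set: 'I_n] i + l (val i)}.
  move=> i _; rewrite /deficit cardsT card_ord.
  have := longest_card (G i) [set: 'I_n]; rewrite cardsT card_ord.
  move: (short i : _ < l (val i)); move: (longest _ _) (l _) => a b.
  by nat_lia.
rewrite (perm_size ps) size_enum_ord.
have : binary_sum [seq l (val i) | i <- s] <= S.
  rewrite SE; apply: binary_sum_sorted sorted_l.
  rewrite -val_enum_ord -map_comp; exact: perm_map ps.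
move: (binary_sum [seq deficit _ _ _ | _ <- _]) => D.
move: (binary_sum _) => L; move: (2 ^ t) two_t S2 => X.
(* From [D < n] and [L <= S] follows [n.+1 * X <= D + L + n.+1 <= S + 2 * n]; subtracting [2 * n.+1]
   leaves [S - 2] on the right. *)
rewrite mulnBr; nia.
Qed.
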